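(* Let $G$ be a graph and let $M$ be a module of $G$ with $|M|\ge 3$. Denote by $P_i$ the path on $i$ vertices, and define a graph $G'$ as follows. \begin{itemize} \item If $o(G[M])=\mathcal{D}$, let $G'$ be the graph obtained from $G$ by replacing $M$ by a copy of $P_2$. \item If $o(G[M])=\mathcal{S}$, let $G'$ be the graph obtained from $G$ by replacing $M$ by two independent (non-adjacent) vertices. \item If $o(G[M])=\mathcal{N}$, let $G'$ be the graph obtained from $G$ by replacing $M$ by a copy of $P_3$. \end{itemize} Then $G$ and $G'$ have the same outcome, i.e. $o(G)=o(G')$.
   Context: All graphs are finite, simple and undirected. $N[x]$ denotes the closed neighborhood of $x$, and $G[M]$ is the subgraph induced by $M$. The Maker-Breaker domination game on a graph $G$ is played by Dominator and Staller, who alternately claim one unclaimed vertex of $G$. Dominator wins if the vertices she claims contain a dominating set of $G$; otherwise (i.e. if Staller claims the whole closed neighborhood of some vertex) Staller wins. The outcome $o(G)$ is: $\mathcal{D}$ if Dominator has a winning strategy both playing first and playing second; $\mathcal{S}$ if Staller has a winning strategy both playing first and playing second; $\mathcal{N}$ if the player who moves first has a winning strategy. (These are the only possibilities.) A module of $G$ is a set $M\subseteq V(G)$ such that $N[x]\setminus M=N[y]\setminus M$ for all $x,y\in M$. A vertex outside $M$ is adjacent to $M$ if it is adjacent to all vertices of $M$. Replacing $M$ by a graph $H$ means: removing the vertices of $M$ from $G$, adding a copy of $H$, and adding all edges between vertices of $H$ and the vertices of $G\setminus M$ that were adjacent to $M$. *)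

(* Defs.v *)
From mathcomp Require Import all_boot.
Set Implicit Arguments.
Unset Strict Implicit.
Unset Printing Implicit Defensive.

Record sgraph := SGraph {
  vertex :> finType;
  adj : rel vertex;
  adj_sym : symmetric adj;
  adj_irr : irreflexive adj }.

Definition closed_nbhd (G : sgraph) (x : G) : {set G} :=
  [set y | (y == x) || adj x y].

Definition is_module (G : sgraph) (M : {set G}) : Prop :=
  forall x y, x \in M -> y \in M ->
    closed_nbhd x :\: M = closed_nbhd y :\: M.

Definition dominating (G : sgraph) (A : {set G}) : bool :=
  [forall x, [exists y in A, y \in closed_nbhd x]].

Section Induced.
Variables (G : sgraph) (M : {set G}).

Definition induced_adj : rel {x | x \in M} := fun x y => adj (val x) (val y).

Lemma induced_sym : symmetric induced_adj.
Proof. by move=> x y; apply: adj_sym. Qed.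

Lemma induced_irr : irreflexive induced_adj.
Proof. by move=> x; apply: adj_irr. Qed.

Definition induced : sgraph := SGraph induced_sym induced_irr.
End Induced.

Section Replace.
Variables (G : sgraph) (M : {set G}) (H : sgraph).

Definition adjacent_to_set (x : G) : bool := [forall y in M, adj x y].

Definition replace_adj : rel ({x | x \in ~: M} + H) := fun u v =>
  match u, v with
  | inl x, inl y => adj (val x) (val y)
  | inr a, inr b => adj a b
  | inl x, inr _ | inr _, inl x => adjacent_to_set (val x)
  end.

Lemma replace_sym : symmetric replace_adj.
Proof. by case=> [x|a] [y|b] //=; apply: adj_sym. Qed.

Lemma replace_irr : irreflexive replace_adj.
Proof. by case=> [x|a] /=; apply: adj_irr. Qed.

Definition replace_module : sgraph := SGraph replace_sym replace_irr.
End Replace.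

Section SmallGraphs.
Variable n : nat.

Definition path_adj : rel 'I_n := fun i j => (i.+1 == j) || (j.+1 == i).

Lemma path_sym : symmetric path_adj.
Proof. by move=> i j; apply: orbC. Qed.

Lemma path_irr : irreflexive path_adj.
Proof. by move=> i; rewrite /path_adj orbb gtn_eqF. Qed.

Definition path_graph : sgraph := SGraph path_sym path_irr.

Definition edgeless_adj : rel 'I_n := fun _ _ => false.

Lemma edgeless_sym : symmetric edgeless_adj.
Proof. by []. Qed.

Lemma edgeless_irr : irreflexive edgeless_adj.
Proof. by []. Qed.

Definition edgeless_graph : sgraph := SGraph edgeless_sym edgeless_irr.
End SmallGraphs.

Definition player := bool.
Definition Dominator : player := true.
Definition Staller : player := false.

(* A history is the sequence of the vertices claimed so far, in order; when   *)
(* [f] moves first, the vertex of index [i] is claimed by [to_move f i].      *)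
Definition to_move (f : player) (i : nat) : player := f (+) odd i.

Section Game.
Variable G : sgraph.

Definition claimed (f p : player) (h : seq G) : {set G} :=
  [set x in h | to_move f (index x h) == p].

(* A play goes on until every vertex is claimed: claiming further vertices    *)
(* cannot change who wins.                                                    *)
Definition complete_play (s : seq G) : Prop := uniq s /\ size s = #|G|.

Definition winner (f : player) (s : seq G) : player :=
  if [exists A : {set G}, (A \subset claimed f Dominator s) && dominating A]
  then Dominator else Staller.

(* The [option] only serves the graph without vertices, for which there would *)
(* be no function [seq G -> G].                                               *)
Definition strategy := seq G -> option G.

Definition legal (sigma : strategy) : Prop :=
  forall h, uniq h -> size h < #|G| -> exists2 x, sigma h = Some x & x \notin h.

Definition follows (f p : player) (sigma : strategy) (s : seq G) : Prop :=
  forall h x t, s = h ++ x :: t -> to_move f (size h) = p -> sigma h = Some x.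

Definition winning_strategy (f p : player) (sigma : strategy) : Prop :=
  legal sigma /\
  forall s, complete_play s -> follows f p sigma s -> winner f s = p.

Definition has_winning_strategy (f p : player) : Prop :=
  exists sigma, winning_strategy f p sigma.
End Game.

Variant outcome_type := OutcomeD | OutcomeS | OutcomeN.

Definition has_outcome (G : sgraph) (o : outcome_type) : Prop :=
  match o with
  | OutcomeD => forall f, has_winning_strategy G f Dominator
  | OutcomeS => forall f, has_winning_strategy G f Staller
  | OutcomeN => forall f, has_winning_strategy G f f
  end.

(* The rest of the file shows that each graph has exactly one outcome: finite *)
(* games are determined, and moving first is never a disadvantage.            *)

Section Determinacy.
Variable G : sgraph.
Implicit Types (f p : player) (h s : seq G).

Lemma exists_unclaimed h : size h < #|G| -> exists x, x \notin h.
Proof.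
move=> lt_hG; apply/existsP; rewrite -negb_forall; apply/negP => /forallP hT.
have : #|G| <= size h; last by rewrite leqNgt lt_hG.
apply: leq_trans (card_size h); apply: subset_leq_card.
by apply/subsetP => x _; apply: hT.
Qed.

Fixpoint can_win p n f h : bool :=
  if n is n'.+1 then
    if to_move f (size h) == p
    then [exists x, (x \notin h) && can_win p n' f (rcons h x)]
    else [forall x, (x \notin h) ==> can_win p n' f (rcons h x)]
  else winner f h == p.

Lemma can_winN p n f h : can_win (~~ p) n f h = ~~ can_win p n f h.
Proof.
elim: n h => [|n IHn] h /=; first by case: (winner f h); case: (p).
have -> : (to_move f (size h) == ~~ p) = (to_move f (size h) != p).
  by case: (to_move f (size h)); case: (p).
case: eqP => _ /=.
  rewrite negb_exists; apply: eq_forallb => x.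
  by rewrite IHn negb_and -implybE.
rewrite negb_forall; apply: eq_existsb => x.
by rewrite IHn negb_imply.
Qed.

Definition can_win_strategy p f : strategy G := fun h =>
  if [pick x | (x \notin h) && can_win p (#|G| - (size h).+1) f (rcons h x)]
    is Some x then Some x else [pick x | x \notin h].

Lemma can_win_has_winning_strategy p f :
  can_win p #|G| f [::] -> has_winning_strategy G f p.
Proof.
move=> w0; exists (can_win_strategy p f); split.
  move=> h _ /exists_unclaimed[x0 x0h]; rewrite /can_win_strategy.
  case: pickP => [x /andP[xh _]|_]; first by exists x.
  by case: pickP => [x xh|/(_ x0)]; [exists x | rewrite x0h].
move=> s [Us sz_s] Fs.
suff /(_ s [::]): forall h t, s = h ++ t -> can_win p (#|G| - size h) f h.
  by rewrite cats0 sz_s subnn => /(_ erefl)/eqP.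
elim/last_ind => [|h x IHh] t; first by rewrite subn0.
rewrite cat_rcons => def_s; have := IHh _ def_s.
have lt_hG : size h < #|G|.
  by rewrite -sz_s def_s size_cat /= -addSnnS leq_addr.
have xh : x \notin h.
  by move: Us; rewrite def_s cat_uniq /= negb_or => /and3P[_ /andP[]].
rewrite size_rcons -subnSK //=; case: eqP => [tm|_ /forallP/(_ x)]; last first.
  by rewrite xh.
case/existsP=> y yP; have := Fs _ _ _ def_s tm; rewrite /can_win_strategy.
by case: pickP => [z /andP[_ wz] [<-]|/(_ y)] //; rewrite yP.
Qed.

Lemma winning_strategy_excl f p :
  has_winning_strategy G f p -> has_winning_strategy G f (~~ p) -> False.
Proof.
case=> sg [sgL sgW] [tu [tuL tuW]].
have [s [Us sz_s Fsg Ftu]] : exists s,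
    [/\ uniq s, size s = #|G|, follows f p sg s & follows f (~~ p) tu s].
  suff: forall n, n <= #|G| -> exists s,
    [/\ uniq s, size s = n, follows f p sg s & follows f (~~ p) tu s].
    by apply.
  elim=> [_|n IHn lt_nG]; first by exists [::]; split=> // -[].
  have [h [Uh sz_h Fsg Ftu]] := IHn (ltnW lt_nG).
  have [rho [rhoL rhoE]] : exists rho : strategy G, legal rho /\
      forall x, rho h = Some x ->
      (to_move f (size h) = p -> sg h = Some x) /\
      (to_move f (size h) = ~~ p -> tu h = Some x).
    case: (eqVneq (to_move f (size h)) p) => [->|nE].
      by exists sg; split=> // x ->; split=> //; case: (p).
    by exists tu; split=> // x ->; split=> // E; case/eqP: nE.
  have [|x /rhoE[xsg xtu] xh] := rhoL h Uh; first by rewrite sz_h.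
  have ext q ro : follows f q ro h ->
    (to_move f (size h) = q -> ro h = Some x) -> follows f q ro (rcons h x).
    move=> Fh Ex h' y t; case/lastP: t => [|t z].
      by rewrite cats1 => /rcons_inj[<- <-].
    rewrite -rcons_cons -rcons_cat => /rcons_inj[def_h _]; exact: Fh def_h.
  exists (rcons h x); rewrite rcons_uniq xh size_rcons sz_h.
  by split=> //; apply: ext.
have := sgW s (conj Us sz_s) Fsg; rewrite (tuW s (conj Us sz_s) Ftu).
by case: (p).
Qed.

Lemma claimed_rcons f h x : x \notin h ->
  claimed f Dominator (rcons h x) =
  if to_move f (size h) then x |: claimed f Dominator h
  else claimed f Dominator h.
Proof.
move=> xh; have dE (t : player) : (t == Dominator) = t by case: t.
apply/setP => y; rewrite inE dE mem_rcons inE -cats1 index_cat /=.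
have [->|nyx] /= := eqVneq y x.
  rewrite (negPf xh) ?eqxx addn0.
  by case: (to_move _ _); rewrite !inE ?eqxx // (negPf xh).
by case: (to_move f (size h)); rewrite !inE dE ?(negPf nyx); case: (y \in h).
Qed.

Definition has_dominating (A : {set G}) : bool :=
  [exists B : {set G}, (B \subset A) && dominating B].

Fixpoint set_win n (t : player) (A U : {set G}) : bool :=
  if n is n'.+1 then
    if t then [exists x in U, set_win n' (~~ t) (x |: A) (U :\ x)]
    else [forall x in U, set_win n' (~~ t) A (U :\ x)]
  else has_dominating A.

Lemma can_win_set n f h : can_win Dominator n f h =
  set_win n (to_move f (size h)) (claimed f Dominator h) [set x | x \notin h].
Proof.
elim: n h => [|n IHn] h /=.
  by rewrite /winner -/(has_dominating _); case: (has_dominating _).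
have E x : x \notin h ->
  can_win Dominator n f (rcons h x) = set_win n (~~ to_move f (size h))
   (if to_move f (size h) then x |: claimed f Dominator h
    else claimed f Dominator h) ([set y | y \notin h] :\ x).
  move=> xh; rewrite IHn claimed_rcons // size_rcons.
  have -> : to_move f (size h).+1 = ~~ to_move f (size h).
    by rewrite /to_move /= addbN.
  by congr set_win; apply/setP => y; rewrite !inE mem_rcons inE negb_or.
case: (to_move f (size h)) E => E /=.
  by apply: eq_existsb => x; rewrite inE; case: (boolP (x \in h)) => //= /E.
by apply: eq_forallb => x; rewrite inE; case: (boolP (x \in h)) => //= /E.
Qed.

Lemma has_dominatingU x (A : {set G}) :
  has_dominating A -> has_dominating (x |: A).
Proof.
case/existsP=> B /andP[BA dB]; apply/existsP; exists B.
by rewrite dB (subset_trans BA) ?subsetUr.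
Qed.

Lemma setD1C (U : {set G}) x y : U :\ x :\ y = U :\ y :\ x.
Proof. by rewrite !setDDl setUC. Qed.

Lemma set_win_tempo n :
  (forall (A U : {set G}), #|U| = n ->
     set_win n Staller A U -> set_win n Dominator A U) /\
  (forall t (A U : {set G}) x, #|U| = n.+1 -> x \in U ->
     set_win n.+1 t A U -> set_win n t (x |: A) (U :\ x)).
Proof.
have cD1 m (U : {set G}) x : x \in U -> #|U| = m.+1 -> #|U :\ x| = m.
  by move=> xU; rewrite (cardsD1 x) xU => -[].
elim: n => [|n [IH1 IH2]].
  split=> // t A U x cU xU; case: t => /=.
    case/existsP=> y /andP[yU]; suff -> : y = x by [].
    by move/eqP/cards1P: cU xU yU => [z ->] /set1P-> /set1P->.
  by move/forallP/(_ x); rewrite xU; apply: has_dominatingU.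
have H1 (A U : {set G}) : #|U| = n.+1 ->
    set_win n.+1 Staller A U -> set_win n.+1 Dominator A U.
  move=> cU wU; have [x xU] : exists x, x \in U.
    by apply/set0Pn; rewrite -card_gt0 cU.
  by apply/existsP; exists x; rewrite xU; apply: IH2 wU.
split=> // t A U x cU xU; case: t => wU.
  have {wU} /existsP[y /andP[yU wy]] := wU.
  have [eyx|nyx] := eqVneq y x.
    by rewrite eyx in wy; apply: H1 wy; apply: cD1.
  apply/existsP; exists y; rewrite !inE nyx yU /= setD1C setUCA.
  by apply: (IH2 Staller (y |: A) (U :\ y) x) => //;
    [apply: cD1 | rewrite !inE eq_sym nyx].
apply/forallP => y; apply/implyP; rewrite !inE => /andP[nyx yU].
have /forallP/(_ y) := wU; rewrite yU => wy; rewrite setD1C.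
by apply: (IH2 Dominator A (U :\ y) x) => //;
  [apply: cD1 | rewrite !inE eq_sym nyx].
Qed.

Lemma can_win_first :
  can_win Dominator #|G| Staller [::] -> can_win Dominator #|G| Dominator [::].
Proof.
rewrite !can_win_set; have -> : [set x | x \notin [::]] = [set: G].
  by apply/setP => x; rewrite !inE.
have E f : claimed f Dominator [::] = set0 :> {set G}.
  by apply/setP => x; rewrite !inE.
by rewrite !E; apply: (set_win_tempo _).1; rewrite cardsT.
Qed.

Lemma outcome_exists : {o | has_outcome G o}.
Proof.
have W p f := @can_win_has_winning_strategy p f.
case wS: (can_win Dominator #|G| Staller [::]).
  by exists OutcomeD => -[]; apply: W => //; apply: can_win_first.
have {}wS : can_win Staller #|G| Staller [::] by rewrite (can_winN Dominator) wS.
case wD: (can_win Dominator #|G| Dominator [::]).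
  by exists OutcomeN => -[]; apply: W.
by exists OutcomeS => -[]; apply: W => //; rewrite (can_winN Dominator) wD.
Qed.

Lemma has_outcome_inj o o' : has_outcome G o -> has_outcome G o' -> o = o'.
Proof.
have X f := @winning_strategy_excl f Dominator.
by case: o o' => [] [] //= w w'; exfalso;
  first [ exact: (X Dominator (w _) (w' _)) | exact: (X Dominator (w' _) (w _))
        | exact: (X Staller (w _) (w' _)) | exact: (X Staller (w' _) (w _)) ].
Qed.
End Determinacy.

Definition outcome (G : sgraph) : outcome_type := sval (outcome_exists G).

Lemma outcomeP (G : sgraph) (o : outcome_type) :
  outcome G = o <-> has_outcome G o.
Proof.
have Go : has_outcome G (outcome G) := svalP (outcome_exists G).
by split=> [<- | /(has_outcome_inj Go)].
Qed.

(* Main.v *)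
(* Claiming a vertex of M dominates all neighbours of M outside M, and claiming
   such a neighbour dominates M.  Hence the winner on G depends on G[M] only
   through its outcome, by comparison with a game played outside M:
   - if o(G[M]) = D, Dominator, playing second inside M, dominates M and its
     neighbours, so only the vertices not adjacent to M matter;
   - if o(G[M]) = S, Staller, playing second inside M, forces Dominator to
     claim a neighbour of M; as |M| >= 2, Dominator can also claim a vertex of
     M by a pairing strategy, so all that is left for her is to claim such a
     neighbour and to dominate the vertices not adjacent to M;
   - if o(G[M]) = N, the first player inside M decides between the two previous
     cases, so M acts as a single extra vertex; here |M| >= 3 lets Dominator
     still claim a vertex of M after Staller's first move there.
   These comparisons hold for G' as well, with the same outside game. *)

Require Import Defs.
From mathcomp Require Import all_boot.

Set Implicit Arguments.
Unset Strict Implicit.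
Unset Printing Implicit Defensive.

(** * Games with passing for an arbitrary goal, and their determinacy *)

Section Games.
Variable T : finType.
Implicit Types (W : pred {set T}) (t : bool) (A B C U V : {set T}) (x : T).

(* [t] says whether our player is to move; [A] is what she owns and [U] what
   is still unclaimed.  She may pass. *)
Inductive wins W : bool -> {set T} -> {set T} -> Prop :=
| wins_now t A U : W A -> wins W t A U
| wins_pass A U : wins W false A U -> wins W true A U
| wins_move x A U : x \in U -> wins W false (x |: A) (U :\ x) -> wins W true A U
| wins_reply A U : U != set0 -> (forall x, x \in U -> wins W true A (U :\ x)) ->
    wins W false A U.

(** The opponent's goal, in terms of the set [B] owned by the opponent: [W] fails even if everything
    outside [B] goes to the player. *)
Definition dual_goal W : pred {set T} := fun B => ~~ W (~: B).

Definition nonempty : pred {set T} := fun A => A != set0.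

Lemma wins_trueP W A U : wins W true A U ->
  wins W false A U \/ exists2 x, x \in U & wins W false (x |: A) (U :\ x).
Proof.
move Et: true => t w; case: w Et => [{}t {}A {}U wA _|{}A {}U w _|x {}A {}U xU w _|] //.
- by left; apply: wins_now.
- by left.
- by right; exists x.
Qed.

Lemma wins_falseP W A U : wins W false A U ->
  W A \/ U != set0 /\ forall x, x \in U -> wins W true A (U :\ x).
Proof.
move Et: false => t w; case: w Et => [{}t {}A {}U wA _|//|//|{}A {}U U0 w _].
  by left.
by right.
Qed.

Lemma wins_false_reply W A U x :
  wins W false A U -> x \in U -> wins W true A (U :\ x).
Proof. by case/wins_falseP=> [wA _|[_]]; [apply: wins_now | apply]. Qed.

Lemma wins_sub W W' t A U :
  (forall B, W B -> W' B) -> wins W t A U -> wins W' t A U.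
Proof.
move=> WW'; elim=> {t A U} [t A U /WW'|A U _|x A U xU _|A U U0 _] w.
- exact: wins_now.
- exact: wins_pass.
- exact: wins_move w.
- exact: wins_reply.
Qed.

Lemma cardsD1_eq n U x : x \in U -> #|U| = n.+1 -> #|U :\ x| = n.
Proof. by move=> xU; rewrite (cardsD1 x) xU => -[]. Qed.

Lemma wins_nonempty U : 1 < #|U| -> wins nonempty false set0 U.
Proof.
case Ek: #|U| => [|[|k]] // _; apply: wins_reply => [|x xU].
  by rewrite -card_gt0 Ek.
have [y yU] : exists y, y \in U :\ x.
  by apply/set0Pn; rewrite -card_gt0 (@cardsD1_eq k.+1 U x).
apply: wins_move yU _; apply: wins_now.
by apply/set0Pn; exists y; rewrite !inE eqxx.
Qed.

(** The game without passing, with exactly [n] moves left. Being boolean it can be negated, whereas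
    [wins] combines well across boards; [set_win] is the case of domination. *)
Fixpoint goal_win W n t A U : bool :=
  if n is n'.+1 then
    if t then [exists x in U, goal_win W n' (~~ t) (x |: A) (U :\ x)]
    else [forall x in U, goal_win W n' (~~ t) A (U :\ x)]
  else W A.

Lemma goal_win_wins W n t A U : #|U| = n -> goal_win W n t A U -> wins W t A U.
Proof.
elim: n t A U => [|n IHn] t A U cU /=; first exact: wins_now.
case: t => [/existsP[x /andP[xU w]]|/forallP w].
  by apply: (wins_move xU); apply: IHn; first apply: cardsD1_eq.
apply: wins_reply => [|x xU]; first by rewrite -card_gt0 cU.
by apply: IHn; [apply: cardsD1_eq | have := w x; rewrite xU].
Qed.

Lemma disjoint_setU1 x A B :
  [disjoint x |: A & B] = (x \notin B) && [disjoint A & B].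
Proof. by rewrite -!setI_eq0 setIUl setU_eq0 !setI_eq0 disjoints1. Qed.

(** Negation exchanges the two quantifiers, hence the two players. As [A], [B] and [U] partition the
    board, the final sets of the players are complementary. *)
Lemma goal_winN W n t A B U :
  [disjoint A & B] -> U = ~: (A :|: B) -> #|U| = n ->
  ~~ goal_win W n t A U = goal_win (dual_goal W) n (~~ t) B U.
Proof.
elim: n t A B U => [|n IHn] t A B U dAB dU cU /=.
  rewrite /dual_goal; congr (~~ W _); apply/setP=> x.
  have := in_set0 x; rewrite -(cards0_eq cU) dU !inE negb_or.
  have := disjointFr dAB (x := x).
  by case: (x \in A) => [->|_] //; case: (x \in B).
case: t => /=.
  rewrite negb_exists; apply: eq_forallb => x; rewrite negb_and -implybE.
  case: (boolP (x \in U)) => //= xU.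
  have xAB: x \notin A :|: B by rewrite -in_setC -dU.
  rewrite -(IHn false (x |: A)) //; last exact: cardsD1_eq.
    rewrite disjoint_setU1 dAB andbT; apply: contra xAB => xB.
    by rewrite inE xB orbT.
  by apply/setP=> y; rewrite dU !inE !negb_or; case: eqP.
rewrite negb_forall; apply: eq_existsb => x; rewrite negb_imply.
case: (boolP (x \in U)) => //= xU.
have xAB: x \notin A :|: B by rewrite -in_setC -dU.
rewrite -(IHn true A) //; last exact: cardsD1_eq.
  rewrite disjoint_sym disjoint_setU1 [X in _ && X]disjoint_sym dAB andbT.
  by apply: contra xAB => xB; rewrite inE xB.
by apply/setP=> y; rewrite dU !inE !negb_or; case: eqP; rewrite ?andbF.
Qed.

(** Monotonicity preserves an early win until the board is full, and the tempo hypothesis converts a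
    pass into an actual move. *)
Lemma wins_goal_win W n t A U :
  (forall B C, B \subset C -> W B -> W C) ->
  (forall m B V, [disjoint B & V] -> #|V| = m ->
     goal_win W m false B V -> goal_win W m true B V) ->
  [disjoint A & U] -> #|U| = n -> wins W t A U -> goal_win W n t A U.
Proof.
move=> W_mono tempo + + w.
elim: w n => {t A U} [t A U wA|A U _ IH|x A U xU _ IH|A U U0 _ IH] n dAU cU.
- elim: n t A U wA cU {dAU} => [|n IHn] t A U wA cU //=.
  have [x xU] : exists x, x \in U by apply/set0Pn; rewrite -card_gt0 cU.
  case: t.
    apply/existsP; exists x; rewrite xU; apply: IHn; last exact: cardsD1_eq.
    by apply: W_mono wA; apply: subsetUr.
  by apply/forallP=> y; apply/implyP=> yU; apply: IHn; rewrite ?(cardsD1_eq yU cU).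
- by apply: tempo => //; apply: IH.
- case: n cU => [/cards0_eq U0|n cU]; first by rewrite U0 inE in xU.
  apply/existsP; exists x; rewrite xU; apply: IH; last exact: cardsD1_eq.
  rewrite disjoint_setU1 !inE eqxx /=.
  by apply: disjointWr dAU; apply: subD1set.
- case: n cU => [/cards0_eq E|n cU]; first by rewrite E eqxx in U0.
  apply/forallP=> x; apply/implyP=> xU; apply: IH => //; last exact: cardsD1_eq.
  by apply: disjointWr dAU; apply: subD1set.
Qed.

Lemma wins_determined W t :
  if goal_win W #|T| t set0 setT then wins W t set0 setT
  else wins (dual_goal W) (~~ t) set0 setT.
Proof.
case: ifPn => [|]; first by apply: goal_win_wins; rewrite cardsT.
rewrite (@goal_winN _ _ _ _ set0) ?cardsT //; first last.
- by rewrite setU0 setC0.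
- by rewrite -setI_eq0 setI0.
by apply: goal_win_wins; rewrite cardsT.
Qed.

End Games.

Arguments nonempty {T}.

(** * Games on a board split into two parts *)

Section Product.
Variables (T T1 T2 : finType) (f1 : T1 -> T) (f2 : T2 -> T).
Hypotheses (f1_inj : injective f1) (f2_inj : injective f2).
Hypothesis f12 : forall x y, f1 x != f2 y.
Hypothesis f_onto : forall z, (exists x, z = f1 x) \/ (exists y, z = f2 y).
Implicit Types (W : pred {set T}) (A B U : {set T}) (t : bool).

Lemma preim1U1 x A : f1 @^-1: (f1 x |: A) = x |: f1 @^-1: A.
Proof. by apply/setP=> y; rewrite !inE inj_eq. Qed.

Lemma preim1D1 x A : f1 @^-1: (A :\ f1 x) = (f1 @^-1: A) :\ x.
Proof. by apply/setP=> y; rewrite !inE inj_eq. Qed.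

Lemma preim1U2 y A : f1 @^-1: (f2 y |: A) = f1 @^-1: A.
Proof. by apply/setP=> x; rewrite !inE (negPf (f12 _ _)). Qed.

Lemma preim1D2 y A : f1 @^-1: (A :\ f2 y) = f1 @^-1: A.
Proof. by apply/setP=> x; rewrite !inE f12. Qed.

Lemma preim2U2 x A : f2 @^-1: (f2 x |: A) = x |: f2 @^-1: A.
Proof. by apply/setP=> y; rewrite !inE inj_eq. Qed.

Lemma preim2D2 x A : f2 @^-1: (A :\ f2 x) = (f2 @^-1: A) :\ x.
Proof. by apply/setP=> y; rewrite !inE inj_eq. Qed.

Lemma preim2U1 y A : f2 @^-1: (f1 y |: A) = f2 @^-1: A.
Proof. by apply/setP=> x; rewrite !inE eq_sym (negPf (f12 _ _)). Qed.

Lemma preim2D1 y A : f2 @^-1: (A :\ f1 y) = f2 @^-1: A.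
Proof. by apply/setP=> x; rewrite !inE eq_sym f12. Qed.

(** Each move of the opponent is answered in the part where it was made, by a pass if the strategy
    there passes. So the player is never on the move in both parts. *)
Lemma wins_prod W (W1 : pred {set T1}) (W2 : pred {set T2}) t1 t2 A U :
  (forall B, W1 (f1 @^-1: B) -> W2 (f2 @^-1: B) -> W B) ->
  ~~ (t1 && t2) ->
  wins W1 t1 (f1 @^-1: A) (f1 @^-1: U) ->
  wins W2 t2 (f2 @^-1: A) (f2 @^-1: U) -> wins W (t1 || t2) A U.
Proof.
move=> W12; elim: {U}_.+1 {-2}U (ltnSn #|U|) t1 t2 A => // n IHn U leUn t1 t2 A.
have ltD1 z : z \in U -> #|U :\ z| < n.
  by move=> zU; move: leUn; rewrite (cardsD1 z) zU ltnS.
(* The opponent is to move in both parts. On an empty board no reply is possible, so both goals must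
   already be met. *)
have FF B : wins W1 false (f1 @^-1: B) (f1 @^-1: U) ->
    wins W2 false (f2 @^-1: B) (f2 @^-1: U) -> wins W false B U.
  move=> w1 w2; have [U0|U0] := eqVneq U set0.
    case/wins_falseP: w1 => [w1|[]]; last by rewrite U0 preimset0 eqxx.
    case/wins_falseP: w2 => [w2|[]]; last by rewrite U0 preimset0 eqxx.
    by apply: wins_now; apply: W12.
  apply: wins_reply => // z zU; have ltz := ltD1 z zU.
  case: (f_onto z) => [[x Ez]|[y Ez]]; subst z.
    apply: (IHn _ ltz true false) => //; first rewrite preim1D1.
      by apply: wins_false_reply; rewrite // inE.
    by rewrite preim2D1.
  apply: (IHn _ ltz false true) => //; first by rewrite preim1D2.
  by rewrite preim2D2; apply: wins_false_reply; rewrite // inE.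
case: t1 t2 => [] [] //= _ w1 w2.
- case/wins_trueP: w1 => [w1|[x]]; first by apply: wins_pass; apply: FF.
  rewrite inE -preim1U1 -preim1D1 => xU w1; apply: (@wins_move _ _ (f1 x)) => //.
  by apply: (IHn _ _ false false); rewrite ?ltD1 ?preim2U1 ?preim2D1.
- case/wins_trueP: w2 => [w2|[x]]; first by apply: wins_pass; apply: FF.
  rewrite inE -preim2U2 -preim2D2 => xU w2; apply: (@wins_move _ _ (f2 x)) => //.
  by apply: (IHn _ _ false false); rewrite ?ltD1 ?preim1U2 ?preim1D2.
- exact: FF.
Qed.

(** The board gains a vertex [None], whose ownership selects the goal to be met on [T1]. *)
Definition option_goal (W : bool -> pred {set T1}) : pred {set option T1} :=
  fun A : {set option T1} => W (None \in A) (Some @^-1: A).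

(** With [None] no longer available, the index of the goal is fixed and only moves in [T1]
    remain. *)
Lemma wins_option (W : bool -> pred {set T1}) t (A1 U1 : {set option T1}) :
  None \notin U1 ->
  wins (option_goal W) t A1 U1 ->
  wins (W (None \in A1)) t (Some @^-1: A1) (Some @^-1: U1).
Proof.
move=> + w; elim: w => {t A1 U1} [t A U wA _|A U _ w NU|[x|] A U xU _ w NU|A U U0 _ w NU].
- exact: wins_now.
- by apply: wins_pass; apply: w.
- apply: (@wins_move _ _ x); first by rewrite inE.
  have := w _; rewrite !inE /= => /(_ NU).
  have -> : Some @^-1: (Some x |: A) = x |: Some @^-1: A.
    by apply/setP=> y; rewrite !inE.
  suff -> : Some @^-1: (U :\ Some x) = (Some @^-1: U) :\ x by [].
  by apply/setP=> y; rewrite !inE.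
- by rewrite xU in NU.
- apply: wins_reply => [|x]; first by case/set0Pn: U0 NU => -[x xU _|->//];
    apply/set0Pn; exists x; rewrite inE.
  rewrite inE => xU; have := w _ xU; rewrite !inE /= => /(_ NU).
  suff -> : Some @^-1: (U :\ Some x) = (Some @^-1: U) :\ x by [].
  by apply/setP=> y; rewrite !inE.
Qed.

(* The vertex [None] stands for the right to be the first to play in [T2]. *)
Lemma wins_subst W (W1 : bool -> pred {set T1}) (W2a W2b : pred {set T2})
    t (A1 U1 : {set option T1}) A U :
  (forall B, W1 true (f1 @^-1: B) -> W2a (f2 @^-1: B) -> W B) ->
  (forall B, W1 false (f1 @^-1: B) -> W2b (f2 @^-1: B) -> W B) ->
  wins W2a true set0 setT ->
  (forall y, wins W2b false set0 (setT :\ y)) -> 0 < #|T2| ->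
  wins (option_goal W1) t A1 U1 ->
  None \notin A1 -> None \in U1 ->
  Some @^-1: A1 = f1 @^-1: A -> Some @^-1: U1 = f1 @^-1: U ->
  f2 @^-1: A = set0 -> f2 @^-1: U = setT -> wins W t A U.
Proof.
move=> gT gF wa wb T2_gt0 w; elim: w A U => {t A1 U1}.
(* The goal on [T1] is met without [None], so [W2b] suffices on [T2]; a pass answers the opponent's
   first claim there. *)
- move=> t A1 U1 wA A U NA NU EA EU EA2 EU2.
  suff w : wins W false A U by case: t; first apply: wins_pass.
  apply: (@wins_prod _ (W1 false) W2b false false) => //.
    by apply: wins_now; move: wA; rewrite /option_goal (negPf NA) EA.
  rewrite EA2 EU2; apply: wins_reply; first by rewrite -card_gt0 cardsT.
  by move=> y _; apply: wins_pass.
- move=> A1 U1 _ IH A U NA NU EA EU EA2 EU2; apply: wins_pass; exact: IH.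
- case=> [x|] A1 U1 xU w IH A U NA NU EA EU EA2 EU2.
    apply: (@wins_move _ _ (f1 x)).
      by move/setP/(_ x): EU; rewrite !inE xU.
    apply: IH; rewrite ?preim2U1 ?preim2D1 ?preim1U1 ?preim1D1 -?EA -?EU ?inE //.
      by apply/setP=> y; rewrite !inE.
    by apply/setP=> y; rewrite !inE.
  (* Claiming [None] becomes taking the first turn in [T2]; from then on the two parts are
     independent. *)
  apply: (@wins_prod _ (W1 true) W2a false true); rewrite ?EA2 ?EU2 //.
  have := @wins_option _ _ _ _ _ w; rewrite !inE eqxx /= => /(_ isT).
  congr wins; first by rewrite -EA; apply/setP=> y; rewrite !inE.
  by rewrite -EU; apply/setP=> y; rewrite !inE.
move=> A1 U1 U0 w IH A U NA NU EA EU EA2 EU2.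
apply: wins_reply => [|z].
  have /card_gt0P[y _] := T2_gt0; apply/set0Pn; exists (f2 y).
  by move/setP/(_ y): EU2; rewrite !inE.
case: (f_onto z) => [[x ->] xU|[y ->] yU].
  have xU1 : Some x \in U1 by move/setP/(_ x): EU; rewrite !inE xU.
  apply: (IH _ xU1); rewrite ?preim2D1 ?preim1D1 -?EU ?inE //.
  by apply/setP=> x'; rewrite !inE.
(* The opponent's first claim in [T2] is read as claiming [None], which leaves the player on the
   move in [T1]. *)
apply: (@wins_prod _ (W1 false) W2b true false) => //.
  have := @wins_option _ _ _ _ _ (w _ NU); rewrite !inE eqxx /= => /(_ isT).
  rewrite (negPf NA) EA preim1D2 -EU; congr wins.
  by apply/setP=> x; rewrite !inE.
by rewrite EA2 preim2D2 EU2.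
Qed.

End Product.

(** * From games with passing to the outcome of a graph *)

Section Graph.
Variable G : sgraph.
Implicit Types (A B C U V : {set G}) (t : bool).

Lemma dominatingS A B : A \subset B -> dominating A -> dominating B.
Proof.
move=> AB /forallP dA; apply/forallP=> x; have /existsP[y /andP[yA yx]] := dA x.
by apply/existsP; exists y; rewrite (subsetP AB).
Qed.

Lemma has_dominatingE A : has_dominating A = dominating A.
Proof.
apply/existsP/idP => [[B /andP[]]|dA]; first exact: dominatingS.
by exists A; rewrite subxx.
Qed.

Lemma set_winE n t A U : set_win n t A U = goal_win (@dominating G) n t A U.
Proof.
elim: n t A U => [|n IHn] t A U /=; first exact: has_dominatingE.
case: t; first by apply: eq_existsb => x; rewrite IHn.
by apply: eq_forallb => x; rewrite IHn.
Qed.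

Definition dominator_wins t := set_win #|G| t set0 [set: G].

Lemma dominator_winsP t :
  wins (@dominating G) t set0 setT -> dominator_wins t.
Proof.
move=> w; rewrite /dominator_wins set_winE; apply: wins_goal_win w.
- exact: dominatingS.
- move=> m B V _ cV; rewrite -!set_winE; exact: (set_win_tempo G m).1.
- by rewrite -setI_eq0 set0I.
- by rewrite cardsT.
Qed.

(** Here [t] says whether Staller is to move. Staller's tempo property is the contrapositive of
    Dominator's. *)
Lemma dominator_winsPn t :
  wins (dual_goal (@dominating G)) t set0 setT -> ~~ dominator_wins (~~ t).
Proof.
move=> w; rewrite /dominator_wins set_winE.
rewrite (@goal_winN _ _ _ _ _ set0) ?cardsT //; first last.
- by rewrite setU0 setC0.
- by rewrite -setI_eq0 setI0.
rewrite negbK; apply: wins_goal_win w; rewrite ?cardsT //.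
- by move=> B C BC; apply: contra; apply: dominatingS; rewrite setCS.
- move=> m B V dBV cV.
  have dVC : V = ~: (~: (B :|: V) :|: B).
    apply/setP=> x; rewrite !inE; have := disjointFr dBV (x := x).
    by case: (x \in B) => [->|_] //; case: (x \in V).
  have dC : [disjoint ~: (B :|: V) & B].
    by rewrite disjoint_sym -subsets_disjoint subsetUl.
  (* The flags are written as negations so that [goal_winN] applies backwards, with [~: (B :|: V)]
     as Dominator's vertices. *)
  rewrite -[false]/(~~ true) -[true in X in _ -> X]/(~~ false).
  rewrite -!(goal_winN _ _ dC dVC cV); apply: contra.
  by rewrite -!set_winE; apply: (set_win_tempo G m).1.
- by rewrite -setI_eq0 set0I.
Qed.

Lemma outcomeE :
  outcome G = if dominator_wins false then OutcomeD
              else if dominator_wins true then OutcomeN else OutcomeS.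
Proof.
have E f : can_win Dominator #|G| f ([::] : seq G) = dominator_wins f.
  rewrite can_win_set /dominator_wins /to_move addbF.
  have -> : claimed f Dominator [::] = set0 :> {set G}.
    by apply/setP=> x; rewrite !inE.
  suff -> : [set x : G | x \notin [::]] = setT by [].
  by apply/setP=> x; rewrite !inE.
have W p f := @can_win_has_winning_strategy G p f.
have N f : ~~ dominator_wins f -> has_winning_strategy G f Staller.
  by rewrite -E -can_winN => /W.
have D f : dominator_wins f -> has_winning_strategy G f Dominator.
  by rewrite -E => /W.
apply/outcomeP; case: ifPn => [w|w].
  move=> [] /=; [apply: W; apply: can_win_first; rewrite E|apply: D]; exact: w.
case: ifPn => [w'|w'] [] /=; by [apply: D | apply: N].
Qed.

End Graph.

Lemma dominator_wins_determined (G : sgraph) t :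
  if dominator_wins G t then wins (@dominating G) t set0 setT
  else wins (dual_goal (@dominating G)) (~~ t) set0 setT.
Proof. by rewrite /dominator_wins set_winE; apply: wins_determined. Qed.

(** * Outcomes of the three replacement graphs *)

Lemma outcome_path2 : outcome (path_graph 2) = OutcomeD.
Proof.
rewrite outcomeE dominator_winsP //.
apply: (@wins_sub _ nonempty); last by apply: wins_nonempty; rewrite cardsT card_ord.
move=> A /set0Pn[y yA]; apply/forallP=> x; apply/existsP; exists y.
by rewrite yA inE; case: x y {yA} => [[|[|x]] //= ?] [[|[|y]] //= ?].
Qed.

Lemma outcome_edgeless2 : outcome (edgeless_graph 2) = OutcomeS.
Proof.
have w : wins (dual_goal (@dominating (edgeless_graph 2))) false set0 setT.
  (* A single vertex is a whole closed neighbourhood here, so Staller needs just one. *)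
  apply: (@wins_sub _ nonempty); last by apply: wins_nonempty; rewrite cardsT card_ord.
  move=> A /set0Pn[x xA]; rewrite /dual_goal negb_forall; apply/existsP; exists x.
  apply/existsPn=> y; rewrite negb_and !inE orbF negbK.
  by have [->|] := eqVneq y x; rewrite ?xA ?orbT.
rewrite outcomeE (negPf (dominator_winsPn w)).
by rewrite (negPf (dominator_winsPn (wins_pass w))).
Qed.

Lemma outcome_path3 : outcome (path_graph 3) = OutcomeN.
Proof.
set G := path_graph 3; pose c : G := inord 1.
have Ec : val c = 1 by rewrite /= inordK.
have wD : dominator_wins G true.
  apply: dominator_winsP; apply: (wins_move (in_setT c)); apply: wins_now.
  apply/forallP=> x; apply/existsP; exists c; rewrite !inE eqxx /=.
  rewrite /path_adj Ec -val_eqE /= Ec.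
  by case: x => [[|[|[|x]]] //= ?].
have wS : wins (dual_goal (@dominating G)) true set0 setT.
  apply: (wins_move (in_setT c)).
  apply: wins_reply => [|x].
    by apply/set0Pn; exists ord0; rewrite !inE -val_eqE /= Ec.
  rewrite !inE andbT -val_eqE Ec => xc.
  (* [rev_ord] swaps the ends of the path: [y] is the end left by Dominator, and [y] with the centre
     [c] is its closed neighbourhood. *)
  pose y : G := rev_ord x.
  apply: (@wins_move _ _ y).
    by rewrite !inE -!val_eqE /= Ec; case: x xc @y => [[|[|[|x]]] //= ?].
  apply: wins_now; rewrite /dual_goal negb_forall; apply/existsP; exists y.
  apply/existsPn=> z; rewrite negb_and !inE negbK orbF -!val_eqE /= /path_adj /= Ec.
  by case: x xc @y => [[|[|[|x]]] //= ?] _; case: z => [[|[|[|z]]] //= ?].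
by rewrite outcomeE (negPf (dominator_winsPn wS)) wD.
Qed.

(** * Splitting the domination game into a module and its outside *)

Section Decomposition.
Variables (O : finType) (r : rel O) (N : pred O).

(* [N v] says that [v] is adjacent to the module, and [b] that Dominator has
   the upper hand in the module. *)
Definition reduced_goal (b : bool) : pred {set O} := fun A =>
  [forall v, ~~ N v ==> [exists y in A, (y == v) || r v y]]
  && (b || [exists y in A, N y]).

(** It depends on the module only through its outcome, so two graphs with the same outside can be
    compared through it. *)
Definition reduced_value (o : outcome_type) t :=
  match o with
  | OutcomeD => goal_win (reduced_goal true) #|O| t set0 setT
  | OutcomeS => goal_win (reduced_goal false) #|O| t set0 setT
  | OutcomeN =>
    goal_win (option_goal reduced_goal) #|{: option O}| t set0 setT
  end.

Variables (K H : sgraph) (f1 : O -> K) (f2 : H -> K).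
Hypotheses (f1_inj : injective f1) (f2_inj : injective f2).
Hypothesis f12 : forall x y, f1 x != f2 y.
Hypothesis f_onto : forall z, (exists x, z = f1 x) \/ (exists y, z = f2 y).
Hypothesis adj11 : forall x y, adj (f1 x) (f1 y) = r x y.
Hypothesis adj12 : forall x a, adj (f1 x) (f2 a) = N x.
Hypothesis adj22 : forall a b, adj (f2 a) (f2 b) = adj a b.

Lemma adj21 x a : adj (f2 a) (f1 x) = N x.
Proof. by rewrite adj_sym adj12. Qed.

(** A dominating set of [H] is nonempty, hence also dominates every neighbour of the module. *)
Lemma dominating_module (A : {set K}) :
  0 < #|H| -> reduced_goal true (f1 @^-1: A) -> dominating (f2 @^-1: A) ->
  dominating A.
Proof.
case/card_gt0P=> a _ /andP[/forallP far _] /forallP domH.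
apply/forallP=> z; have [[x ->]|[b ->]] := f_onto z.
  case Nx: (N x).
    have /existsP[b /andP[bA _]] := domH a; rewrite inE in bA.
    by apply/existsP; exists (f2 b); rewrite bA inE adj12 Nx orbT.
  have := far x; rewrite Nx => /existsP[y /andP[yA xy]].
  by apply/existsP; exists (f1 y); rewrite inE in yA; rewrite yA inE inj_eq // adj11.
have /existsP[c /andP[cA bc]] := domH b; rewrite !inE in cA bc.
by apply/existsP; exists (f2 c); rewrite cA inE inj_eq // adj22.
Qed.

Lemma dominating_outside (A : {set K}) :
  reduced_goal false (f1 @^-1: A) -> nonempty (f2 @^-1: A) -> dominating A.
Proof.
case/andP=> /forallP far /existsP[y0 /andP[y0A Ny0]] /set0Pn[b bA].
rewrite inE in y0A; rewrite inE in bA.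
apply/forallP=> z; have [[x ->]|[a ->]] := f_onto z.
  case Nx: (N x).
    by apply/existsP; exists (f2 b); rewrite bA inE adj12 Nx orbT.
  have := far x; rewrite Nx => /existsP[y /andP[yA xy]].
  by apply/existsP; exists (f1 y); rewrite inE in yA; rewrite yA inE inj_eq // adj11.
by apply/existsP; exists (f1 y0); rewrite y0A inE adj21 Ny0 orbT.
Qed.

Lemma dominating_reduced (A : {set K}) :
  dominating A -> reduced_goal true (f1 @^-1: A).
Proof.
move/forallP=> domA; rewrite /reduced_goal andbT; apply/forallP=> x.
apply/implyP=> Nx; have /existsP[z] := domA (f1 x).
have [[y ->]|[b ->]] := f_onto z; rewrite inE.
  by rewrite inj_eq // adj11 => yA; apply/existsP; exists y; rewrite inE.
by rewrite adj12 (negPf Nx) eq_sym (negPf (f12 _ _)) andbF.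
Qed.

(** If no neighbour of the module is claimed, the module can be dominated only from within. *)
Lemma dominating_module_or_outside (A : {set K}) :
  dominating A -> dominating (f2 @^-1: A) || reduced_goal false (f1 @^-1: A).
Proof.
move=> domA; have /andP[far _] := dominating_reduced domA.
rewrite /reduced_goal far /= orbC -implyNb; apply/implyP=> /existsPn nbrs.
apply/forallP=> a; have /existsP[z] := forallP domA (f2 a).
have [[y ->]|[b ->]] := f_onto z; rewrite inE.
  rewrite adj21 (negPf (f12 _ _)) => /andP[yA /= Ny].
  by have := nbrs y; rewrite inE yA /= Ny.
by rewrite inj_eq // adj22 => yA; apply/existsP; exists b; rewrite !inE.
Qed.

(** [wins_determined] names a winner of the reduced game; for each outcome of [H], that player's
    strategy is combined with one on [H]. *)
Lemma dominator_wins_reduced t :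
  1 < #|H| -> (outcome H = OutcomeN -> 2 < #|H|) ->
  dominator_wins K t = reduced_value (outcome H) t.
Proof.
move=> H2 H3; have HD := dominator_wins_determined H.
have H_gt0 : 0 < #|H| by apply: ltnW.
have prod (W : pred {set K}) (W1 : pred {set O}) (W2 : pred {set H}) s :
    (forall B : {set K}, W1 (f1 @^-1: B) -> W2 (f2 @^-1: B) -> W B) ->
    wins W1 s set0 setT -> wins W2 false set0 setT -> wins W s set0 setT.
  move=> gW w1 w2; rewrite -[s]orbF.
  by apply: (wins_prod f1_inj f2_inj f12 f_onto gW);
    rewrite ?andbF // ?preimset0 ?preimsetT.
have wins_true : wins xpredT false set0 [set: H] by apply: wins_now.
move: H3; rewrite outcomeE; move: (HD false) (HD true).
case: (dominator_wins H false) => [wD _ _|wS].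
  rewrite /reduced_value; have := wins_determined (reduced_goal true) t.
  case: ifP => _ w.
    apply: dominator_winsP; apply: prod w wD => B; exact: dominating_module.
  (* Staller moves first exactly when [t] is false. A vertex left undominated away from the module
     is enough, so Staller's goal in [H] is trivial. *)
  apply/negbTE; rewrite -[t]negbK; apply: dominator_winsPn.
  apply: prod w wins_true => B; rewrite /dual_goal -preimsetC => + _.
  apply: contra; exact: dominating_reduced.
case: (dominator_wins H true) => [wD /(_ erefl) H3|wS' _].
  rewrite /reduced_value; have := wins_determined (option_goal reduced_goal) t.
  have subst (W : pred {set K}) (W1 : bool -> pred {set O}) (W2a W2b : pred {set H}) s :
      (forall B : {set K}, W1 true (f1 @^-1: B) -> W2a (f2 @^-1: B) -> W B) ->
      (forall B : {set K}, W1 false (f1 @^-1: B) -> W2b (f2 @^-1: B) -> W B) ->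
      wins W2a true set0 setT ->
      (forall y, wins W2b false set0 (setT :\ y)) ->
      wins (option_goal W1) s set0 setT -> wins W s set0 setT.
    move=> gT gF wa wb w.
    by apply: (wins_subst f1_inj f2_inj f12 f_onto gT gF wa wb H_gt0 w);
      rewrite ?inE ?preimset0 ?preimsetT.
  case: ifP => _ w.
    apply: dominator_winsP.
    apply: subst dominating_outside wD _ w => [|y].
      by move=> B; apply: dominating_module.
    (* Since [2 < #|H|], two vertices remain after Staller's claim of [y], and Dominator gets one of
       them. *)
    by apply: wins_nonempty; rewrite (@cardsD1_eq _ #|H|.-1) ?cardsT ?prednK // -ltnS prednK.
  apply/negbTE; rewrite -[t]negbK; apply: dominator_winsPn.
  (* The flag [b] now records that Staller owns [None], so Dominator's goal is taken at [~~ b].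
     Starting in [H], Staller keeps Dominator from dominating it. *)
  apply: (subst _ (fun b => dual_goal (reduced_goal (~~ b))) _ xpredT _ _ _ wS).
  - move=> B; rewrite /dual_goal -!preimsetC => w1 w2.
    by apply: contra w1 => /dominating_module_or_outside; rewrite (negPf w2).
  - move=> B; rewrite /dual_goal -preimsetC => + _.
    apply: contra; exact: dominating_reduced.
  - by move=> y; apply: wins_now.
  - by apply: wins_sub w => B; rewrite /dual_goal /option_goal preimsetC in_setC.
rewrite /reduced_value; have := wins_determined (reduced_goal false) t.
case: ifP => _ w.
  apply: dominator_winsP; have w2 : wins nonempty false set0 [set: H].
    by apply: wins_nonempty; rewrite cardsT.
  by apply: prod w w2 => B; apply: dominating_outside.
apply/negbTE; rewrite -[t]negbK; apply: dominator_winsPn.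
apply: prod w wS' => B; rewrite /dual_goal -!preimsetC => w1 w2.
by apply: contra w1 => /dominating_module_or_outside; rewrite (negPf w2).
Qed.

End Decomposition.

Theorem lemma4p1 (G : sgraph) (M : {set G}) :
  is_module M -> 3 <= #|M| ->
  let G' := replace_module M
    match outcome (induced M) with
    | OutcomeD => path_graph 2
    | OutcomeS => edgeless_graph 2
    | OutcomeN => path_graph 3
    end in
  outcome G = outcome G'.
Proof.
move=> modM M3 G'.
pose O := {x | x \in ~: M}; pose r (x y : O) := adj (val x) (val y).
pose N (x : O) := adjacent_to_set M (val x).
(* By the module property, adjacency to one vertex of [M] is adjacency to all of them. *)
have adjM (x : O) (y : induced M) : adj (val x) (val y) = N x.
  apply/idP/forallP => [xy z|/(_ (val y))]; last by rewrite (valP y).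
  apply/implyP=> zM; have := modM _ _ (valP y) zM.
  have xM : val x \notin M by rewrite -in_setC (valP x).
  have xz : (val x == z) = false by apply: contraNF xM => /eqP->.
  by move/setP/(_ (val x)); rewrite !inE xM xz ![adj _ (val x)]adj_sym xy orbT.
have GE t : dominator_wins G t = reduced_value r N (outcome (induced M)) t.
  apply: (@dominator_wins_reduced O r N G (induced M) val val).
  - exact: val_inj.
  - exact: val_inj.
  - by move=> x y; apply: contraTneq (valP y) => <-; rewrite -in_setC (valP x).
  - move=> z; case: (boolP (z \in M)) => zM; first by right; exists (Sub z zM).
    by left; rewrite -in_setC in zM; exists (Sub z zM).
  - by [].
  - exact: adjM.
  - by [].
  - by rewrite card_sig ltnW.
  - by rewrite card_sig.
have G'E t : dominator_wins G' t = reduced_value r N (outcome (induced M)) t.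
  rewrite {}/G'; set H := (X in replace_module M X).
  (* [H] was chosen with the outcome of [G[M]], so both graphs have the same reduced value. *)
  have -> : outcome (induced M) = outcome H.
    rewrite /H; case: (outcome (induced M)).
    - by rewrite outcome_path2.
    - by rewrite outcome_edgeless2.
    - by rewrite outcome_path3.
  apply: (@dominator_wins_reduced _ _ _ (replace_module M H) _ inl inr) => //.
  - by move=> x y [].
  - by move=> x y [].
  - by case=> x; [left|right]; exists x.
  - by rewrite /H; case: (outcome (induced M)); rewrite card_ord.
  - rewrite /H; case: (outcome (induced M)); rewrite ?card_ord //.
      by rewrite outcome_path2.
    by rewrite outcome_edgeless2.
by rewrite !outcomeE !GE !G'E.
Qed.
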